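(* Let $p$ be an odd prime. For any discrete $A$-module $M$ there is an exact sequence of discrete $A$-modules $$0\to M\xrightarrow{\alpha} UM\xrightarrow{\beta} UM\xrightarrow{\gamma} M\otimes\mathbb{Q}\to0,$$ where $UM=\mathrm{Hom}^{\mathrm{cts}}_{\mathbb{Z}_{(p)}}(A,M)$ is formed from the underlying $\mathbb{Z}_{(p)}$-module of $M$.
   Context: $A$ is the ring of degree zero stable operations in $p$-local complex $K$-theory. Fix $q$ primitive mod $p^2$, $\Psi^q\in A$ the Adams operation, $q_i=q^{(-1)^i\lfloor i/2\rfloor}$, $\Theta_n(X)=\prod_{i=1}^n(X-q_i)$, $\Phi_n=\Theta_n(\Psi^q)$; every element of $A$ is uniquely a convergent sum $\sum_{n\ge0}a_n\Phi_n$ with $a_n\in\mathbb{Z}_{(p)}$, and $A_m=\{\sum_{n\ge m}a_n\Phi_n\}$. An $A$-module $M$ is discrete if each $x\in M$ satisfies $A_nx=0$ for some $n$. For a $\mathbb{Z}_{(p)}$-module $L$, $\mathrm{Hom}^{\mathrm{cts}}_{\mathbb{Z}_{(p)}}(A,L)$ is the set of $\mathbb{Z}_{(p)}$-homomorphisms $f:A\to L$ whose kernel contains some $A_n$ (i.e. continuous for the $A_m$-filtration topology on $A$ and the discrete topology on $L$), an $A$-module via $(af)(t)=f(ta)$; it is a discrete $A$-module. $M\otimes\mathbb{Q}$ carries the $A$-module structure induced from $M$. *)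

(* Defs.v *)
From HB Require Import structures.
From mathcomp Require Import all_boot all_order all_algebra.
Set Implicit Arguments. Unset Strict Implicit. Unset Printing Implicit Defensive.
Import Order.TTheory GRing.Theory Num.Theory.
Local Open Scope ring_scope.

Section OpsA.
Variables (p : nat) (q : int).

Definition pint (x : rat) : bool := coprime `|denq x|%N p.

Lemma pint0 : pint 0. Proof. by rewrite /pint coprime1n. Qed.
Lemma pint1 : pint 1. Proof. by rewrite /pint coprime1n. Qed.

Definition Zp := {x : rat | pint x}.
Definition Zp0 : Zp := exist _ 0 pint0.
Definition Zp1 : Zp := exist _ 1 pint1.
(* projection rat -> Z_(p); only ever applied to elements of Z_(p)
   (the default value is never used mathematically) *)
Definition toZp (x : rat) : Zp := insubd Zp0 x.

Definition qi (i : nat) : rat :=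
  (q%:~R : rat) ^ ((-1) ^+ i * (i./2)%:Z)%R.

Definition Theta (n : nat) : {poly rat} :=
  \prod_(1 <= i < n.+1) ('X - (qi i)%:P).

(** Newton coefficients: for nodes q_{j+1}, q_{j+2}, ...,
    P = sum_k newton j P k * prod_{i=j+1}^{j+k} (X - q_i). *)
Fixpoint newton (j : nat) (P : {poly rat}) (k : nat) : rat :=
  match k with
  | 0 => P.[qi j.+1]
  | k'.+1 => newton j.+1 ((P - (P.[qi j.+1])%:P) %/ ('X - (qi j.+1)%:P)) k'
  end.

(** Structure constants: Theta_m Theta_n = sum_k cA m n k Theta_k. *)
Definition cA (m n k : nat) : rat := newton 0 (Theta m * Theta n) k.

(** The ring A: an element sum_n a_n Phi_n is its coefficient sequence. *)
Definition A := nat -> Zp.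

Definition addA (a b : A) : A := fun n => toZp (val (a n) + val (b n)).
Definition oneA : A := fun n => if n is 0 then Zp1 else Zp0.
Definition zeroA : A := fun _ => Zp0.
(* (sum a_m Phi_m)(sum b_n Phi_n) = sum_k (sum_{m,n<=k} a_m b_n cA m n k) Phi_k *)
Definition mulA (a b : A) : A := fun k =>
  toZp (\sum_(m < k.+1) \sum_(n < k.+1) val (a m) * val (b n) * cA m n k).
Definition constA (c : Zp) : A := fun n => if n is 0 then c else Zp0.
Definition scaleA (c : Zp) (a : A) : A := fun n => toZp (val c * val (a n)).

Definition inAm (m : nat) (a : A) : Prop := forall n, (n < m)%N -> a n = Zp0.

Definition is_Amod (M : zmodType) (act : A -> M -> M) : Prop :=
  [/\ (forall a x y, act a (x + y) = act a x + act a y),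
      (forall a b x, act (addA a b) x = act a x + act b x),
      (forall a b x, act (mulA a b) x = act a (act b x)) &
      (forall x, act oneA x = x)].

Definition is_discrete (M : zmodType) (act : A -> M -> M) : Prop :=
  forall x : M, exists n, forall a, inAm n a -> act a x = 0.

(** Hom^cts_{Z_(p)}(A, M): Z_(p)-linear maps A -> M killing some A_n
    (M viewed as Z_(p)-module through constA). *)
Definition in_UM (M : zmodType) (act : A -> M -> M) (f : A -> M) : Prop :=
  [/\ (forall s t, f (addA s t) = f s + f t),
      (forall c t, f (scaleA c t) = act (constA c) (f t)) &
      exists n, forall t, inAm n t -> f t = 0].

Definition actU (M : zmodType) (a : A) (f : A -> M) : A -> M :=
  fun t => f (mulA t a).

(** (N, iota) is M (x) Q with the induced A-module structure: N is an
    A-module, iota : M -> N is A-linear, N is uniquely p-divisible, every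
    element of N is iota m / p^k, and ker iota is the p-power torsion of M.
    (Since M is a Z_(p)-module, M (x)_Z Q = M (x)_{Z_(p)} Q = M[1/p].) *)
Definition is_tensorQ (M : zmodType) (actM : A -> M -> M)
    (N : zmodType) (actN : A -> N -> N) (iota : M -> N) : Prop :=
  [/\ is_Amod actN,
      (forall x y, iota (x + y) = iota x + iota y) &
      (forall a x, iota (actM a x) = actN a (iota x))] /\
  [/\ (forall y : N, exists z : N, z *+ p = y),
      (forall z : N, z *+ p = 0 -> z = 0),
      (forall y : N, exists (k : nat) (x : M), y *+ (p ^ k) = iota x) &
      (forall x : M, iota x = 0 <-> exists k : nat, x *+ (p ^ k) = 0)].

Definition primitive_mod_p2 : Prop :=
  coprimez q p /\
  forall k : nat, (0 < k)%N -> (q ^+ k == 1 %[mod (p ^ 2)%:Z])%Z ->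
    (p * (p - 1) %| k)%N.

End OpsA.

(* Main.v *)
(* Evaluation at the nodes q_1, q_2, ... identifies A with a ring of rational
   sequences, in which the polynomials in Psi = Psi^q over Z_(p) are dense. Put
   alpha(x)(t) = t x and (beta f)(t) = f(Psi t) - Psi f(t). An element f of UM is
   an arbitrary finitely supported sequence f_n = f(Phi_n), and
   (beta f)_n = f_(n+1) - (Psi - q_(n+1)) f_n; hence beta f = g forces, from
   f_0 = 0, f_n = s_n(g) where s_(n+1)(g) = (Psi - q_(n+1)) s_n(g) + g_n, and the
   obstruction to solvability is that s_n(g) need not vanish for large n.
   The map gamma sends g to the unique y in M (x) Q with
   Theta_n'(Psi) y = s_n(g) for all large n: y exists and is unique because Theta_n
   is separable over Q and Theta_(n+1)' = Theta_n + (X - q_(n+1)) Theta_n'.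
   Since q^i is periodic in i modulo p^k, for all n, m, k some product
   (X - q_(n+1)) ... (X - q_n') lies in the ideal (Theta_m, p^k). So if s_n(g) is
   p-power torsion then s_n'(g) = 0 for some larger n', which gives
   ker gamma = im beta; and if p^k y is in the image of M then so is
   Theta_n'(Psi) y for some large n, which gives surjectivity of gamma. *)
Require Import Defs.
From HB Require Import structures.
From mathcomp Require Import all_boot all_order all_algebra all_solvable all_field.
From mathcomp Require Import zify ring.
From Stdlib Require Import FunctionalExtensionality ClassicalEpsilon.
Set Implicit Arguments. Unset Strict Implicit. Unset Printing Implicit Defensive.
Import Order.TTheory GRing.Theory Num.Theory.
Import Defs.
Local Open Scope ring_scope.

(** * The subring Z_(p) of rat *)

Section LocalIntegers.
Variable p : nat.

Lemma pintP (x : rat) :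
  reflect (exists d : nat, coprime d p /\ exists z : int, x * d%:R = z%:~R)
          (pint p x).
Proof.
apply: (iffP idP) => [xp|[d [dp [z xz]]]].
  exists `|denq x|%N; split=> //; exists (numq x).
  by rewrite -[LHS]/(x * (`|denq x|%N)%:~R) absz_denq -numqE.
have [d0|d0] := posnP d.
  by move: dp; rewrite d0 /coprime gcd0n => /eqP->; rewrite /pint /coprime gcdn1.
have E : numq x * d%:Z = z * denq x.
  apply/eqP; rewrite -(eqr_int rat) !rmorphM /= -xz numqE.
  by apply/eqP; rewrite mulrAC -!mulrA.
have D : (`|denq x| %| d)%N.
  rewrite -(@Gauss_dvdr _ `|numq x|%N); last by rewrite coprime_sym coprime_num_den.
  apply/dvdnP; exists `|z|%N.
  by have := congr1 absz E; rewrite !abszM absz_nat.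
exact: coprime_dvdl D dp.
Qed.

Fact pint_subring : GRing.subring_closed (pint p : {pred rat}).
Proof.
split=> [|x y /pintP[d [dp [z xz]]] /pintP[e [ep [w yw]]]
         |x y /pintP[d [dp [z xz]]] /pintP[e [ep [w yw]]]].
- exact: pint1.
- apply/pintP; exists (d * e)%N; split; first by rewrite coprimeMl dp.
  exists (z * e%:Z - w * d%:Z); rewrite natrM rmorphB !rmorphM /= -xz -yw.
  by rewrite mulrBl; congr (_ - _); rewrite -!mulrA // [d%:R * _]mulrC.
- apply/pintP; exists (d * e)%N; split; first by rewrite coprimeMl dp.
  by exists (z * w); rewrite natrM rmorphM /= -xz -yw mulrACA.
Qed.

HB.instance Definition _ := GRing.isSubringClosed.Build rat (pint p) pint_subring.

Lemma pint_int (z : int) : pint p z%:~R.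
Proof. by apply/pintP; exists 1%N; split; [exact: coprime1n|exists z; rewrite mulr1]. Qed.

Lemma pint_nat (n : nat) : pint p n%:R.
Proof. exact: (pint_int n%:Z). Qed.

Lemma pint_inv (d : nat) : coprime d p -> pint p d%:R^-1.
Proof.
move=> dp; apply/pintP; exists d; split=> //.
have [->|d0] := posnP d; first by exists 0; rewrite mulr0.
by exists 1; rewrite mulVf // pnatr_eq0 -lt0n.
Qed.

Lemma toZpK (x : rat) : pint p x -> val (toZp p x) = x.
Proof. by move=> px; rewrite /toZp val_insubd px. Qed.

Lemma valK_toZp (x : Zp p) : toZp p (val x) = x.
Proof. by rewrite /toZp valKd. Qed.

Lemma val_pint (x : Zp p) : pint p (val x).
Proof. exact: valP x. Qed.

Lemma polyOverMXaddC (P : {poly rat}) (c : rat) :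
  P * 'X + c%:P \is a polyOver (pint p) -> P \is a polyOver (pint p) /\ pint p c.
Proof.
move=> /polyOverP PX; split; last by have := PX 0; rewrite coefD coefMX coefC add0r.
by apply/polyOverP=> i; have := PX i.+1; rewrite coefD coefMX coefC addr0.
Qed.

(** Synthetic division by a monic linear factor never divides coefficients; the quotient is built by
    Horner's recursion. *)
Lemma divXsubC_polyOver (P : {poly rat}) (c : rat) : pint p c ->
  P \is a polyOver (pint p) ->
  (P - P.[c]%:P) %/ ('X - c%:P) \is a polyOver (pint p).
Proof.
move=> pc PZ.
suff [Q QZ ->] : exists2 Q, Q \is a polyOver (pint p) & P - P.[c]%:P = Q * ('X - c%:P).
  by rewrite mulpK // polyXsubC_eq0.
elim/poly_ind: P PZ => [|P a IH] /=.
  by exists 0; rewrite ?rpred0 // horner0 subr0 mul0r.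
move=> /polyOverMXaddC[PZ az]; have [Q QZ E] := IH PZ.
exists (Q * 'X + P.[c]%:P).
  by rewrite rpredD ?rpredM ?polyOverX // polyOverC rpred_horner.
rewrite hornerD hornerMX hornerC.
have -> : P = Q * ('X - c%:P) + P.[c]%:P by rewrite -E subrK.
rewrite !hornerE subrr mulr0 add0r.
rewrite rmorphD rmorphM /=; ring.
Qed.

Lemma newton_pint (q : int) (P : {poly rat}) (j k : nat) :
  (forall i, pint p (qi q i)) -> P \is a polyOver (pint p) ->
  pint p (newton q j P k).
Proof.
move=> qZ; elim: k j P => [|k IH] j P PZ /=; first exact: (rpred_horner PZ (qZ _)).
exact/IH/divXsubC_polyOver.
Qed.

Lemma poly_clear_denominators (P : {poly rat}) :
  exists2 d : nat, (0 < d)%N & d%:R *: P \is a polyOver (pint p).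
Proof.
have [Q [a a0 ->]] := rat_poly_scale P.
exists `|a|%N; first by rewrite absz_gt0.
apply/polyOverP=> i; rewrite !coefZ coef_map /= mulrA.
apply: rpredM; last exact: pint_int.
rewrite -[_%:R]/((`|a|%N)%:~R) abszE.
have a0' : a%:~R != 0 :> rat by rewrite intr_eq0.
case: (ger0P a) => _; rewrite ?rmorphN ?mulNr divff ?rpredN ?rpred1 //=.
Qed.

End LocalIntegers.

(** * The nodes q_i and the polynomials Theta_n *)

Section Nodes.
Variables (p : nat) (q : int).
Hypotheses (p_pr : prime p) (p_odd : odd p) (q_prim : primitive_mod_p2 p q).

Let p_gt2 : (2 < p)%N.
Proof. by case: p p_pr p_odd => [|[|[|]]]. Qed.

Let q_coprime : coprime `|q| p.
Proof. by case: q_prim. Qed.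

Let q_neq0 : q != 0.
Proof.
apply: contraTneq q_coprime => ->; rewrite /coprime gcd0n.
by apply: contraTneq p_gt2 => ->.
Qed.

(** If q were 1 or -1, then q^2 = 1, so primitivity would give p(p-1) | 2, impossible for p > 2. *)
Let normq_gt1 : (1 < `|q|)%N.
Proof.
case: q_prim => _ /(_ 2%N isT).
have [] := ltngtP 1%N `|q|%N => //; first by rewrite ltnS leqn0 absz_eq0 (negPf q_neq0).
move=> q1; have -> : q ^+ 2 = 1 by have [->|->] : q = 1 \/ q = -1 by lia.
by move=> /(_ (eqxx _)) /dvdn_leq-/(_ isT); rewrite leqNgt; nia.
Qed.

Let qr_neq0 : (q%:~R : rat) != 0.
Proof. by rewrite intr_eq0. Qed.

Let expnt (i : nat) : int := (-1) ^+ i * (i./2)%:Z.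

Let qi_expnt i : qi q i = (q%:~R : rat) ^ expnt i.
Proof. by []. Qed.

(** As |q| > 1, absolute values recover the exponent, whose sign and size recover i. Positivity
    matters: indices 0 and 1 both have exponent 0. *)
Lemma qi_inj (i j : nat) : (0 < i)%N -> (0 < j)%N -> qi q i = qi q j -> i = j.
Proof.
have normXz z : `|(q%:~R : rat) ^ z| = `|q%:~R : rat| ^ z.
  by case: z => n; rewrite ?NegzE -?invr_expz ?normfV normrX.
move=> i0 j0 /(congr1 Num.norm); rewrite !normXz.
have nq0 : 0 < `|q%:~R : rat| by rewrite normr_gt0.
have nq1 : `|q%:~R : rat| != 1.
  by rewrite -intr_norm -abszE -[1]/(1%:R) eqr_nat; lia.
move/(ieexprIz nq0 nq1); rewrite /expnt -(signr_odd _ i) -(signr_odd _ j).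
by case: (boolP (odd i)) (boolP (odd j)) => oi [] oj; rewrite /= ?expr0 ?expr1; lia.
Qed.

Lemma pint_q_expz (z : int) : pint p ((q%:~R : rat) ^ z).
Proof.
have qZ := pint_int p q.
have qV : pint p (q%:~R^-1 : rat).
  by rewrite /pint denqVz // absz_id.
by case: z => n; [exact: rpredX|rewrite NegzE -exprz_inv; exact: (rpredX n.+1 qV)].
Qed.

Lemma pint_qi (i : nat) : pint p (qi q i).
Proof. exact: pint_q_expz. Qed.

Lemma ThetaE (n : nat) : Theta q n = \prod_(0 <= i < n) ('X - (qi q i.+1)%:P).
Proof. by rewrite /Theta big_add1. Qed.

Lemma Theta0 : Theta q 0 = 1.
Proof. by rewrite ThetaE big_geq. Qed.

Lemma ThetaS (n : nat) : Theta q n.+1 = Theta q n * ('X - (qi q n.+1)%:P).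
Proof. by rewrite !ThetaE big_nat_recr. Qed.

Lemma Theta_cat (n m : nat) : (n <= m)%N ->
  Theta q m = Theta q n * \prod_(n <= i < m) ('X - (qi q i.+1)%:P).
Proof. by move=> nm; rewrite !ThetaE (big_cat_nat (n := n)). Qed.

Lemma XsubqiZ (i : nat) : 'X - (qi q i)%:P \is a polyOver (pint p).
Proof. by rewrite rpredB ?polyOverX // polyOverC; exact: pint_qi. Qed.

Lemma prod_XsubqiZ (n m : nat) :
  \prod_(n <= i < m) ('X - (qi q i.+1)%:P) \is a polyOver (pint p).
Proof. by apply: rpred_prod => i _; exact: XsubqiZ. Qed.

Lemma ThetaZ (n : nat) : Theta q n \is a polyOver (pint p).
Proof. by rewrite ThetaE prod_XsubqiZ. Qed.

(** Doubling makes the exponent even, so that the power of q equals that of |q| and Euler's theorem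
    on naturals applies. *)
Let period (k : nat) : nat := (totient (p ^ k)).*2.

(** Shifting the index by 2r keeps its parity and moves the exponent by r or -r, where q^r is 1
    modulo p^k. *)
Lemma qi_period (k c i : nat) :
  exists2 z : rat, pint p z &
    qi q (i + (period k * c).*2) = qi q i + (p ^ k)%:R * z.
Proof.
set r := (period k * c)%N.
have qr : exists2 z : int, q ^+ r = 1 + (p ^ k)%:Z * z & True.
  have : (`|q| ^ r = 1 %[mod p ^ k])%N.
    rewrite /r /period -doubleMl -muln2 -mulnA expnM -modnXm Euler_exp_totient.
      by rewrite modnXm exp1n.
    by rewrite coprimeXr // q_coprime.
  have -> : q ^+ r = (`|q| ^ r)%N%:Z.
    by rewrite -abszX gez0_abs // exprn_even_ge0 // /r /period -doubleMl odd_double.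
  move=> /eqP; rewrite eqn_mod_dvd; last by rewrite expn_gt0; lia.
  case/dvdnP=> z; set Q := (_ ^ r)%N => Qz; exists z%:Z => //.
  have : (0 < Q)%N by rewrite expn_gt0; lia.
  by rewrite mulrC -PoszM -Qz; lia.
have [z qrE _] := qr.
have {}qrE : (q%:~R : rat) ^ (r%:Z) = 1 + (p ^ k)%:R * z%:~R.
  by rewrite -[LHS]/(q%:~R ^+ r) -rmorphXn /= qrE rmorphD rmorphM.
have expE : expnt (i + r.*2) = expnt i + (-1) ^+ i * r%:Z.
  rewrite /expnt halfD odd_double andbF add0n doubleK exprD.
  by rewrite -[r.*2]mul2n exprM sqrrN !expr1n mulr1 PoszD mulrDr.
rewrite !qi_expnt expE expfzDr //.
rewrite -signr_odd; case: (odd i); rewrite /= ?expr1 ?expr0 ?mulN1r ?mul1r.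
  (* For odd i the exponent drops by r; from (1 + p^k z) q^(-r) = 1 follows q^(-r) = 1 - p^k z
     q^(-r). *)
  exists (- (q%:~R : rat) ^ expnt i * z%:~R * (q%:~R : rat) ^ (- r%:Z)).
    apply: rpredM; last exact: pint_q_expz.
    by apply: rpredM (pint_int _ _); rewrite rpredN; exact: pint_q_expz.
  have : (q%:~R : rat) ^ r%:Z * (q%:~R : rat) ^ (- r%:Z) = 1.
    by rewrite -expfzDr // subrr.
  rewrite qrE; set a := _ ^ expnt i; set w := _ ^ (- _) => Ew.
  transitivity (a * ((1 + (p ^ k)%:R * z%:~R) * w) - (p ^ k)%:R * (a * z%:~R * w)).
    by ring.
  by rewrite Ew; ring.
exists ((q%:~R : rat) ^ expnt i * z%:~R).
  exact: rpredM (pint_q_expz _) (pint_int _ _).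
by rewrite qrE; ring.
Qed.

(** Take a period shift [s] beyond [n]: the [m] factors starting at [s] multiply to [Theta q m]
    modulo p^k, and the factors between [n] and [s] form [V]. *)
Lemma prod_Xsubqi_mod (n m k : nat) :
  exists2 n' : nat, (n <= n')%N &
  exists V Z : {poly rat},
    [/\ V \is a polyOver (pint p), Z \is a polyOver (pint p) &
     \prod_(n <= i < n') ('X - (qi q i.+1)%:P) = Theta q m * V + (p ^ k)%:R *: Z].
Proof.
set s := (period k * n).*2.
have ns : (n <= s)%N.
  have : (0 < totient (p ^ k))%N by rewrite totient_gt0 expn_gt0; lia.
  by rewrite /s /period; nia.
exists (s + m)%N; first by lia.
rewrite (big_cat_nat (n := s)) //=; last exact: leq_addr.
have [Z ZZ ->] : exists2 Z, Z \is a polyOver (pint p) &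
  \prod_(s <= i < s + m) ('X - (qi q i.+1)%:P) = Theta q m + (p ^ k)%:R *: Z.
  elim: m => [|m [Z ZZ IH]].
    by exists 0; rewrite ?rpred0 // addn0 big_geq // Theta0 scaler0 addr0.
  have [z zZ E] := qi_period k n m.+1.
  exists (Z * ('X - (qi q (s + m).+1)%:P) - z *: Theta q m).
    by rewrite rpredB ?rpredM ?XsubqiZ // -mul_polyC rpredM ?ThetaZ // polyOverC.
  rewrite addnS big_nat_recr ?leq_addr //= IH ThetaS.
  have -> : (s + m).+1 = (m.+1 + (period k * n).*2)%N by rewrite addnC.
  rewrite E -!mul_polyC !rmorphD !rmorphM /=; ring.
exists (\prod_(n <= i < s) ('X - (qi q i.+1)%:P)),
  (\prod_(n <= i < s) ('X - (qi q i.+1)%:P) * Z).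
by split; rewrite ?rpredM ?prod_XsubqiZ // -!mul_polyC; ring.
Qed.

(** Distinct nodes make [Theta q n] separable over the rationals; clearing denominators in the
    Bezout relation leaves a constant [d] that need not be prime to p. *)
Lemma Theta_bezout (n : nat) :
  exists (d : nat) (U V : {poly rat}),
    [/\ (0 < d)%N, U \is a polyOver (pint p), V \is a polyOver (pint p) &
     U * (Theta q n)^`() + V * Theta q n = (d%:R)%:P].
Proof.
have sepT : separable_poly (Theta q n).
  have -> : Theta q n = \prod_(x <- [seq qi q i.+1 | i <- iota 0 n]) ('X - x%:P).
    by rewrite ThetaE big_map /index_iota subn0.
  rewrite separable_prod_XsubC map_inj_uniq ?iota_uniq // => i j.
  by move/qi_inj=> /(_ isT isT) [].
have /Bezout_coprimepP[[U V] /=] : coprimep (Theta q n) (Theta q n)^`() by rewrite unlock in sepT.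
rewrite -size_poly_eq1 => /size_poly1P[c c0 E].
have [d d0 dU] := poly_clear_denominators p (c^-1 *: U).
have [e e0 eV] := poly_clear_denominators p (c^-1 *: V).
exists (d * e)%N, ((d * e)%:R *: (c^-1 *: V)), ((d * e)%:R *: (c^-1 *: U)).
split; first by rewrite muln_gt0 d0.
- rewrite natrM -scalerA -mul_polyC rpredM // polyOverC; exact: pint_nat.
- rewrite natrM mulrC -scalerA -mul_polyC rpredM // polyOverC; exact: pint_nat.
rewrite -!scalerAl -!scalerDr addrC E -!mul_polyC -!polyCM.
by rewrite mulVf // mulr1.
Qed.

End Nodes.

(** * The ring A as a ring of values at the nodes *)

Section OperationRing.
Variables (p : nat) (q : int).
Hypotheses (p_pr : prime p) (p_odd : odd p) (q_prim : primitive_mod_p2 p q).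

Let horner_XsubC (a x : rat) : ('X - a%:P).[x] = x - a.
Proof. by rewrite !hornerE. Qed.

Lemma Theta_root (n j : nat) : (j < n)%N -> (Theta q n).[qi q j.+1] = 0.
Proof.
by move=> jn; rewrite (Theta_cat _ jn) ThetaS !hornerM horner_XsubC subrr mulr0 mul0r.
Qed.

Lemma Theta_neq0 (n : nat) : (Theta q n).[qi q n.+1] != 0.
Proof.
suff H m : (m <= n)%N -> (Theta q m).[qi q n.+1] != 0 by exact: H.
elim: m => [|m IH] mn; first by rewrite Theta0 hornerC oner_neq0.
rewrite ThetaS hornerM; apply: mulf_neq0; first exact/IH/ltnW.
rewrite horner_XsubC subr_eq0.
by apply/eqP => /(qi_inj p_pr p_odd q_prim) => /(_ isT isT); lia.
Qed.

(** Value of the formal series with terms u_k Theta_k at the node q_(j+1); the sum stops at k = j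
    because later Theta_k vanish there. *)
Definition evs (u : nat -> rat) (j : nat) : rat :=
  \sum_(k < j.+1) u k * (Theta q k).[qi q j.+1].

Lemma evs_widen (u : nat -> rat) (j n : nat) : (j < n)%N ->
  evs u j = \sum_(k < n) u k * (Theta q k).[qi q j.+1].
Proof.
move=> jn; rewrite /evs (big_ord_widen n (fun k => u k * (Theta q k).[qi q j.+1])) //.
rewrite [RHS](bigID (fun k : 'I_n => (k < j.+1)%N)) /= [X in _ + X]big1 ?addr0 //.
by move=> k; rewrite -leqNgt => jk; rewrite Theta_root ?mulr0.
Qed.

(** The system is triangular with nonzero diagonal Theta_j(q_(j+1)). The bound [n] allows comparing
    truncations. *)
Lemma evs_inj (u v : nat -> rat) (n : nat) :
  (forall j, (j < n)%N -> evs u j = evs v j) -> forall j, (j < n)%N -> u j = v j.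
Proof.
move=> uv j; elim/ltn_ind: j => j IH jn.
have := uv j jn; rewrite /evs !big_ord_recr /=.
under eq_bigr => k _ do rewrite IH ?(ltn_trans _ jn) //.
by move/addrI/(mulIf (Theta_neq0 j)).
Qed.

(** Newton interpolation from the node of index o + 1 on. The offset is general because each
    recursive step of [newton] drops one node. *)
Lemma horner_newton (o i : nat) (P : {poly rat}) :
  P.[qi q (o + i).+1] =
  \sum_(k < i.+1) newton q o P k *
     (\prod_(o <= l < o + k) ('X - (qi q l.+1)%:P)).[qi q (o + i).+1].
Proof.
elim: i o P => [|i IH] o P.
  by rewrite big_ord1 /= addn0 big_geq // hornerC mulr1.
rewrite big_ord_recl /= addn0 big_geq // hornerC mulr1.
set Q := (P - _) %/ _.
have PE : P = Q * ('X - (qi q o.+1)%:P) + P.[qi q o.+1]%:P.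
  by rewrite divpK ?subrK // dvdp_XsubCl /root !hornerE subrr.
rewrite {1}PE !hornerE addrC; congr (_ + _).
rewrite addnS -addSn IH mulr_suml; apply: eq_bigr => k _.
rewrite -mulrA; congr (_ * _); rewrite /bump add1n addnS.
rewrite [in RHS]big_nat_recl ?leq_addr //= hornerM horner_XsubC mulrC.
by rewrite addSn big_add1.
Qed.

Lemma evs_newton (P : {poly rat}) (j : nat) : evs (newton q 0 P) j = P.[qi q j.+1].
Proof. by rewrite -[j]add0n horner_newton; apply: eq_bigr => k _; rewrite -ThetaE. Qed.

Lemma newton_unique (P : {poly rat}) (u : nat -> rat) (n : nat) :
  (forall j, (j < n)%N -> evs u j = P.[qi q j.+1]) ->
  forall j, (j < n)%N -> newton q 0 P j = u j.
Proof. by move=> uP; apply: evs_inj => j jn; rewrite evs_newton uP. Qed.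

Lemma newton_Theta_mul (P : {poly rat}) (n k : nat) : (k < n)%N ->
  newton q 0 (Theta q n * P) k = 0.
Proof.
move: k; apply: (newton_unique (u := fun=> 0)) => j jn.
by rewrite hornerM Theta_root // mul0r /evs big1 // => i _; rewrite mul0r.
Qed.

(** The product Theta_m Theta_n vanishes at the first max(m, n) nodes; this is what makes
    multiplication in A a finite sum in each degree. *)
Lemma cA_small (m n k : nat) : (k < maxn m n)%N -> cA q m n k = 0.
Proof.
by rewrite leq_max /cA => /orP[] h; [|rewrite mulrC]; rewrite newton_Theta_mul.
Qed.

Lemma cA_pint (m n k : nat) : pint p (cA q m n k).
Proof.
apply: newton_pint (pint_qi p_pr p_odd q_prim) _.
by rewrite rpredM ?(ThetaZ p_pr p_odd q_prim).
Qed.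

(** The embedding of A into rational sequences with pointwise operations. *)
Definition ev (a : A p) : nat -> rat := evs (fun k => val (a k)).

Lemma ev_inj : injective ev.
Proof.
move=> a b ab; apply: functional_extensionality => k; apply: val_inj.
have := @evs_inj (fun i => val (a i)) (fun i => val (b i)) k.+1; apply=> // j _.
by have := congr1 (fun u => u j) ab.
Qed.

Lemma val_addA (a b : A p) (k : nat) : val (addA a b k) = val (a k) + val (b k) :> rat.
Proof. by rewrite toZpK //; apply: rpredD (val_pint _) (val_pint _). Qed.

Lemma val_scaleA (c : Zp p) (a : A p) (k : nat) :
  val (scaleA c a k) = val c * val (a k) :> rat.
Proof. by rewrite toZpK //; apply: rpredM (val_pint _) (val_pint _). Qed.

Lemma val_mulA (a b : A p) (k : nat) : val (mulA q a b k) =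
  \sum_(m < k.+1) \sum_(n < k.+1) val (a m) * val (b n) * cA q m n k.
Proof.
rewrite toZpK //; apply: rpred_sum => m _; apply: rpred_sum => n _.
exact: rpredM (rpredM (val_pint _) (val_pint _)) (cA_pint _ _ _).
Qed.

Lemma ev_addA (a b : A p) (j : nat) : ev (addA a b) j = ev a j + ev b j.
Proof.
by rewrite -big_split; apply: eq_bigr => k _; rewrite val_addA mulrDl.
Qed.

Lemma ev_scaleA (c : Zp p) (a : A p) (j : nat) : ev (scaleA c a) j = val c * ev a j.
Proof.
by rewrite /ev /evs mulr_sumr; apply: eq_bigr => k _; rewrite val_scaleA mulrA.
Qed.

Lemma ev_constA (c : Zp p) (j : nat) : ev (constA c) j = val c.
Proof.
rewrite /ev /evs big_ord_recl big1 /= ?addr0; last by move=> i _; rewrite mul0r.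
by rewrite Theta0 hornerC mulr1.
Qed.

Lemma oneA_const : oneA p = constA (Zp1 p).
Proof. by []. Qed.

Lemma ev_mulA (a b : A p) (j : nat) : ev (mulA q a b) j = ev a j * ev b j.
Proof.
rewrite /ev {1}/evs.
(* The ranges in [mulA] depend on k; extending them by vanishing structure constants makes the sums
   interchangeable, and the sum over k is then the Newton expansion of Theta_m Theta_n. *)
have widen (k : 'I_j.+1) : val (mulA q a b k) =
    \sum_(m < j.+1) \sum_(n < j.+1) val (a m) * val (b n) * cA q m n k.
  have wide (F : nat -> rat) : (forall m, (k < m)%N -> F m = 0) ->
      \sum_(m < k.+1) F m = \sum_(m < j.+1) F m.
    move=> F0; rewrite (big_ord_widen j.+1 F) //.
    rewrite [RHS](bigID (fun m : 'I_j.+1 => (m < k.+1)%N)) /= [X in _ + X]big1 ?addr0 //.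
    by move=> m; rewrite -leqNgt => /F0.
  rewrite val_mulA (wide (fun m => \sum_(n < k.+1) val (a m) * val (b n) * cA q m n k)) => [|m km]; last first.
    by rewrite big1 // => n _; rewrite cA_small ?mulr0 // leq_max km.
  apply: eq_bigr => m _; rewrite (wide (fun n => val (a m) * val (b n) * cA q m n k)) // => n kn.
  by rewrite cA_small ?mulr0 // leq_max kn orbT.
under eq_bigr => k _ do rewrite widen mulr_suml.
rewrite exchange_big /evs /= mulr_suml; apply: eq_bigr => m _.
under eq_bigr => k _ do rewrite mulr_suml.
rewrite exchange_big mulr_sumr; apply: eq_bigr => n _.
rewrite mulrACA -hornerM -evs_newton /evs mulr_sumr.
by apply: eq_bigr => k _; rewrite -mulrA.
Qed.

(** * Ring identities in A, verified on values at the nodes *)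

Lemma mulAC (a b : A p) : mulA q a b = mulA q b a.
Proof.
by apply/ev_inj/functional_extensionality => j; rewrite !ev_mulA mulrC.
Qed.

Lemma mulAA (a b c : A p) : mulA q a (mulA q b c) = mulA q (mulA q a b) c.
Proof.
by apply/ev_inj/functional_extensionality => j; rewrite !ev_mulA mulrA.
Qed.

Lemma mulADl (a b c : A p) : mulA q (addA a b) c = addA (mulA q a c) (mulA q b c).
Proof.
apply/ev_inj/functional_extensionality => j.
by rewrite ev_addA !ev_mulA ev_addA mulrDl.
Qed.

Lemma mulA_constl (c : Zp p) (a : A p) : mulA q (constA c) a = scaleA c a.
Proof.
apply/ev_inj/functional_extensionality => j.
by rewrite ev_mulA ev_scaleA ev_constA.
Qed.

Lemma mulA_scalel (c : Zp p) (a b : A p) :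
  mulA q (scaleA c a) b = scaleA c (mulA q a b).
Proof. by rewrite -!mulA_constl mulAA. Qed.

Lemma mulA_inAm (a b : A p) (n : nat) : inAm n a -> inAm n (mulA q b a).
Proof.
move=> an k kn; apply: val_inj; rewrite val_mulA big1 // => i _.
rewrite big1 // => m _; rewrite an ?mulr0 ?mul0r //.
exact: leq_ltn_trans (ltn_ord m : (m <= k)%N) kn.
Qed.

(** The operation P(Psi^q): [polyA p q 'X] is Psi^q and [polyA p q (Theta q n)] is Phi_n. The
    default of [toZp] is not reached for P over Z_(p). *)
Definition polyA (P : {poly rat}) : A p := fun k => toZp p (newton q 0 P k).

Local Notation Zpoly := (polyOver (pint p)).

Lemma val_polyA (P : {poly rat}) (k : nat) :
  P \is a Zpoly -> val (polyA P k) = newton q 0 P k.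
Proof. by move=> PZ; rewrite toZpK // newton_pint //; exact: pint_qi. Qed.

Lemma ev_polyA (P : {poly rat}) (j : nat) :
  P \is a Zpoly -> ev (polyA P) j = P.[qi q j.+1].
Proof.
by move=> PZ; rewrite -evs_newton; apply: eq_bigr => k _; rewrite val_polyA.
Qed.

Lemma polyAD (P Q : {poly rat}) : P \is a Zpoly -> Q \is a Zpoly ->
  polyA (P + Q) = addA (polyA P) (polyA Q).
Proof.
move=> PZ QZ; apply/ev_inj/functional_extensionality => j.
by rewrite ev_addA !ev_polyA ?rpredD // hornerD.
Qed.

Lemma polyAM (P Q : {poly rat}) : P \is a Zpoly -> Q \is a Zpoly ->
  polyA (P * Q) = mulA q (polyA P) (polyA Q).
Proof.
move=> PZ QZ; apply/ev_inj/functional_extensionality => j.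
by rewrite ev_mulA !ev_polyA ?rpredM // hornerM.
Qed.

Lemma polyAC (c : rat) : pint p c -> polyA c%:P = constA (toZp p c).
Proof.
move=> pc; apply/ev_inj/functional_extensionality => j.
by rewrite ev_constA ev_polyA ?polyOverC // hornerC toZpK.
Qed.

Lemma polyA_Theta_inAm (n : nat) (P : {poly rat}) : inAm n (polyA (Theta q n * P)).
Proof.
move=> k kn; rewrite /polyA newton_Theta_mul //.
by apply: val_inj; rewrite toZpK // pint0.
Qed.

Definition truncA (a : A p) (n : nat) : {poly rat} :=
  \sum_(k < n) val (a k) *: Theta q k.

Lemma truncAZ (a : A p) (n : nat) : truncA a n \is a Zpoly.
Proof.
apply: rpred_sum => k _; rewrite -mul_polyC rpredM ?(ThetaZ p_pr p_odd q_prim) //.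
by rewrite polyOverC; exact: val_pint.
Qed.

(** Density of polynomials in Psi: the truncation has the values of [a] at the first n nodes, hence
    the same Newton coefficients below n. *)
Lemma truncA_tail (a : A p) (n : nat) :
  exists2 t : A p, inAm n t & a = addA (polyA (truncA a n)) t.
Proof.
exists (fun k => if (k < n)%N then Zp0 p else toZp p (val (a k) - newton q 0 (truncA a n) k)).
  by move=> k ->.
apply: functional_extensionality => k; apply: val_inj.
rewrite val_addA val_polyA ?truncAZ //; case: ltnP => kn; last first.
  rewrite toZpK; first by rewrite addrC subrK.
  by apply: rpredB (val_pint _) _; apply: newton_pint (truncAZ _ _); exact: pint_qi.
rewrite addr0; apply/esym; move: k kn; apply: newton_unique => j jn.
rewrite (evs_widen _ jn) horner_sum; apply: eq_bigr => k _.
by rewrite hornerZ.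
Qed.

End OperationRing.

(** * Discrete A-modules and UM *)

Section OperationModule.
Variables (p : nat) (q : int).
Hypotheses (p_pr : prime p) (p_odd : odd p) (q_prim : primitive_mod_p2 p q).
Variables (M : zmodType) (act : A p -> M -> M).
Hypothesis act_mod : is_Amod q act.

Local Notation Zpoly := (polyOver (pint p)).

Definition pact (P : {poly rat}) (x : M) : M := act (polyA p q P) x.

Definition killed_from (n : nat) (x : M) : Prop :=
  forall a, inAm n a -> act a x = 0.

Let actD a x y : act a (x + y) = act a x + act a y.
Proof. by case: act_mod. Qed.

Lemma act0 (a : A p) : act a 0 = 0.
Proof. by apply: (@addrI _ (act a 0)); rewrite -actD !addr0. Qed.

Lemma act_opp (a : A p) (x : M) : act a (- x) = - act a x.
Proof. by apply/eqP; rewrite -subr_eq0 opprK -actD addNr act0. Qed.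

Lemma actMn (a : A p) (x : M) (n : nat) : act a (x *+ n) = act a x *+ n.
Proof. by elim: n => [|n IH]; rewrite ?mulr0n ?act0 // !mulrS actD IH. Qed.

Lemma act_mul (a b : A p) (x : M) : act (mulA q a b) x = act a (act b x).
Proof. by case: act_mod. Qed.

Lemma actAC (a b : A p) (x : M) : act a (act b x) = act b (act a x).
Proof. by rewrite -!act_mul (mulAC p_pr p_odd q_prim). Qed.

Lemma pactD (P Q : {poly rat}) (x : M) : P \is a Zpoly -> Q \is a Zpoly ->
  pact (P + Q) x = pact P x + pact Q x.
Proof. by move=> PZ QZ; rewrite /pact (polyAD p_pr p_odd q_prim) //; case: act_mod. Qed.

Lemma pactB (P Q : {poly rat}) (x : M) : P \is a Zpoly -> Q \is a Zpoly ->
  pact (P - Q) x = pact P x - pact Q x.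
Proof.
by move=> PZ QZ; apply/(canRL (addrK _)); rewrite -pactD ?subrK // rpredB.
Qed.

Lemma pact_mul (P Q : {poly rat}) (x : M) : P \is a Zpoly -> Q \is a Zpoly ->
  pact (P * Q) x = pact P (pact Q x).
Proof. by move=> PZ QZ; rewrite /pact (polyAM p_pr p_odd q_prim) // act_mul. Qed.

Lemma pactr0 (P : {poly rat}) : pact P 0 = 0.
Proof. exact: act0. Qed.

Lemma pactDr (P : {poly rat}) (x y : M) : pact P (x + y) = pact P x + pact P y.
Proof. exact: actD. Qed.

Lemma pactBr (P : {poly rat}) (x y : M) : pact P (x - y) = pact P x - pact P y.
Proof. by rewrite pactDr /pact act_opp. Qed.

Lemma pactMn (P : {poly rat}) (x : M) (n : nat) : pact P (x *+ n) = pact P x *+ n.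
Proof. exact: actMn. Qed.

Lemma pactAC (P Q : {poly rat}) (x : M) : pact P (pact Q x) = pact Q (pact P x).
Proof. exact: actAC. Qed.

Lemma polyA1 : polyA p q 1 = oneA p.
Proof.
rewrite -polyC1 (polyAC p_pr p_odd q_prim) ?pint1 // oneA_const; congr constA.
by apply: val_inj; rewrite toZpK ?pint1.
Qed.

Lemma pact1 (x : M) : pact 1 x = x.
Proof. by rewrite /pact polyA1; case: act_mod. Qed.

Lemma pact0 (x : M) : pact 0 x = 0.
Proof. by rewrite -[0](subrr 0) pactB ?rpred0 // subrr. Qed.

Lemma pact_nat (n : nat) (x : M) : pact (n%:R)%:P x = x *+ n.
Proof.
elim: n => [|n IH]; first by rewrite pact0.
by rewrite mulrS rmorphD pactD ?rpred1 ?polyOverC ?IH ?pact1 ?mulrS //; exact: pint_nat.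
Qed.

Lemma act_const (c : Zp p) (x : M) : act (constA c) x = pact (val c)%:P x.
Proof. by rewrite /pact (polyAC p_pr p_odd q_prim) ?valK_toZp // val_pint. Qed.

(** The inverse of [d] lies in Z_(p) and acts on the module. *)
Lemma mulrn_coprime_inj (d : nat) (x : M) : coprime d p -> x *+ d = 0 -> x = 0.
Proof.
move=> dp xd.
have [d0|d0] := posnP d.
  by move: dp p_pr; rewrite d0 /coprime gcd0n => /eqP->.
have dV : (d%:R^-1)%:P \is a Zpoly by rewrite polyOverC; exact: pint_inv.
have dZ : (d%:R)%:P \is a Zpoly by rewrite polyOverC; exact: pint_nat.
rewrite -[x]pact1 -polyC1 -(@mulVf _ (d%:R)) ?pnatr_eq0 -?lt0n // polyCM.
by rewrite pact_mul // pact_nat xd /pact act0.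
Qed.

Lemma mulrn_coprime_div (d : nat) (x : M) : coprime d p -> exists y, y *+ d = x.
Proof.
move=> dp.
have [d0|d0] := posnP d.
  by move: dp p_pr; rewrite d0 /coprime gcd0n => /eqP->.
have dV : (d%:R^-1)%:P \is a Zpoly by rewrite polyOverC; exact: pint_inv.
have dZ : (d%:R)%:P \is a Zpoly by rewrite polyOverC; exact: pint_nat.
exists (pact (d%:R^-1)%:P x); rewrite -pact_nat -pact_mul // -polyCM mulfV ?pact1 //.
by rewrite pnatr_eq0 -lt0n.
Qed.

Lemma killed_from_act (n : nat) (a : A p) (x : M) :
  killed_from n x -> killed_from n (act a x).
Proof. by move=> nx b bn; rewrite actAC nx // act0. Qed.

Lemma killed_from_leq (m n : nat) (x : M) :
  (m <= n)%N -> killed_from m x -> killed_from n x.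
Proof. by move=> mn mx a an; apply: mx => k km; apply: an; exact: leq_trans km mn. Qed.

Lemma pact_killed (n : nat) (P : {poly rat}) (x : M) :
  killed_from n x -> pact (Theta q n * P) x = 0.
Proof. by apply; exact: polyA_Theta_inAm. Qed.

Lemma act_truncA (n : nat) (a : A p) (x : M) :
  killed_from n x -> act a x = pact (truncA q a n) x.
Proof.
move=> nx; have [t tn {1}->] := truncA_tail p_pr p_odd q_prim a n.
by case: act_mod => _ -> _ _; rewrite (nx t) // addr0.
Qed.

(** * UM as the finitely supported sequences of values on the Phi_k *)

Lemma UM_actU (a : A p) (f : A p -> M) : in_UM act f -> in_UM act (actU q a f).
Proof.
case=> fD fZ [n fn]; split=> [s t|c t|].
- by rewrite /actU (mulADl p_pr p_odd q_prim) fD.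
- by rewrite /actU (mulA_scalel p_pr p_odd q_prim) fZ.
exists n => t tn; apply: fn; rewrite (mulAC p_pr p_odd q_prim).
exact: mulA_inAm tn.
Qed.

Lemma UM_poly0 (f : A p -> M) : in_UM act f -> f (polyA p q 0) = 0.
Proof.
by case=> fD fZ [n]; apply; rewrite -[0](mulr0 (Theta q n)); exact: polyA_Theta_inAm.
Qed.

Lemma UM_polyD (f : A p -> M) (P Q : {poly rat}) : in_UM act f ->
  P \is a Zpoly -> Q \is a Zpoly ->
  f (polyA p q (P + Q)) = f (polyA p q P) + f (polyA p q Q).
Proof. by case=> fD _ _ PZ QZ; rewrite (polyAD p_pr p_odd q_prim). Qed.

Lemma UM_polyZ (f : A p -> M) (c : rat) (P : {poly rat}) : in_UM act f ->
  pint p c -> P \is a Zpoly -> f (polyA p q (c *: P)) = pact c%:P (f (polyA p q P)).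
Proof.
case=> _ fZ _ cZ PZ; rewrite -mul_polyC (polyAM p_pr p_odd q_prim) ?polyOverC //.
by rewrite (polyAC p_pr p_odd q_prim) // (mulA_constl p_pr p_odd q_prim) fZ act_const toZpK.
Qed.

Lemma UM_truncA (f : A p -> M) (n : nat) (t : A p) :
  in_UM act f -> (forall t, inAm n t -> f t = 0) -> f t = f (polyA p q (truncA q t n)).
Proof.
case=> fD _ _ fn; have [u un {1}->] := truncA_tail p_pr p_odd q_prim t n.
by rewrite fD (fn u) // addr0.
Qed.

Lemma UM_poly_truncA (f : A p -> M) (n : nat) (t : A p) : in_UM act f ->
  f (polyA p q (truncA q t n)) =
  \sum_(k < n) pact (val (t k))%:P (f (polyA p q (Theta q k))).
Proof.
move=> fU; elim: n => [|n IH]; first by rewrite /truncA !big_ord0 UM_poly0.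
rewrite /truncA !big_ord_recr /= UM_polyD //; first last.
- rewrite -mul_polyC rpredM ?(ThetaZ p_pr p_odd q_prim) //.
  by rewrite polyOverC; exact: val_pint.
- exact: (truncAZ p_pr p_odd q_prim).
rewrite -/(truncA q t n) IH UM_polyZ ?(ThetaZ p_pr p_odd q_prim) //; exact: val_pint.
Qed.

(** Both maps kill a common A_n, so an argument may be truncated to a finite Z_(p)-combination of
    the Phi_k. *)
Lemma UM_ext (f g : A p -> M) : in_UM act f -> in_UM act g ->
  (forall k, f (polyA p q (Theta q k)) = g (polyA p q (Theta q k))) -> f = g.
Proof.
move=> fU gU fg; apply: functional_extensionality => t.
have [_ _ [m fm]] := fU; have [_ _ [n gn]] := gU.
have fk : forall t, inAm (maxn m n) t -> f t = 0.
  by move=> u uk; apply: fm => i im; apply: uk; rewrite leq_max im.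
have gk : forall t, inAm (maxn m n) t -> g t = 0.
  by move=> u uk; apply: gn => i im; apply: uk; rewrite leq_max im orbT.
rewrite (UM_truncA t fU fk) (UM_truncA t gU gk) !UM_poly_truncA //.
by apply: eq_bigr => k _; rewrite fg.
Qed.

Lemma UM_Theta_eventually0 (f : A p -> M) : in_UM act f ->
  exists n, forall k, (n <= k)%N -> f (polyA p q (Theta q k)) = 0.
Proof.
case=> _ _ [n fn]; exists n => k nk; apply: fn => i ik.
by rewrite -[Theta q k]mulr1 polyA_Theta_inAm // (leq_trans ik nk).
Qed.

(** Pairs the coefficients of the argument with [u]; the finite support gives continuity. *)
Lemma UM_of_seq (u : nat -> M) (n : nat) : (forall k, (n <= k)%N -> u k = 0) ->
  exists2 f, in_UM act f & forall k, f (polyA p q (Theta q k)) = u k.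
Proof.
move=> u0; exists (fun t => \sum_(k < n) act (constA (t k)) (u k)).
  split=> [s t|c t|].
  - rewrite -big_split; apply: eq_bigr => k _ /=.
    rewrite !act_const val_addA rmorphD pactD ?polyOverC //; exact: val_pint.
  - rewrite (big_morph (act (constA c)) (actD _) (act0 _)); apply: eq_bigr => k _.
    rewrite !act_const val_scaleA rmorphM pact_mul ?polyOverC //; exact: val_pint.
  exists n => t tn; rewrite big1 // => k _; rewrite tn // act_const /=.
  by rewrite pact0.
move=> k; have TZ := ThetaZ p_pr p_odd q_prim k.
have coef j : val (polyA p q (Theta q k) j) = (j == k)%:R.
  rewrite (val_polyA p_pr p_odd q_prim) //.
  apply: (newton_unique p_pr p_odd q_prim (u := fun i => (i == k)%:R) _ (ltnSn j)) => i _.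
  (* The range must also contain the index [k], where the only nonzero term sits. *)
  rewrite (@evs_widen q _ i (maxn i k).+1) ?ltnS ?leq_maxl //.
  have kk : (k < (maxn i k).+1)%N by rewrite ltnS leq_maxr.
  rewrite (bigD1 (Ordinal kk)) //= eqxx mul1r big1 ?addr0 // => l.
  by rewrite -val_eqE /= => /negPf->; rewrite mul0r.
have [kn|nk] := ltnP k n; last first.
  rewrite u0 // big1 // => j _; rewrite act_const coef.
  by rewrite (_ : (j == k :> nat) = false) ?pact0 //; apply/ltn_eqF/(leq_trans (ltn_ord j)).
rewrite (bigD1 (Ordinal kn)) //= act_const coef eqxx pact1 big1 ?addr0 // => j.
by rewrite -val_eqE /= act_const coef => /negPf->; rewrite pact0.
Qed.

(** * The maps [alpha] and [beta], and exactness at the first UM *)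

Definition alpha (x : M) : A p -> M := act^~ x.

Definition beta (f : A p -> M) : A p -> M :=
  fun t => f (mulA q (polyA p q 'X) t) - pact 'X (f t).

Lemma UM_beta (f : A p -> M) : in_UM act f -> in_UM act (beta f).
Proof.
case=> fD fZ [n fn]; split=> [s t|c t|].
- rewrite /beta !(mulAC p_pr p_odd q_prim (polyA p q 'X)) (mulADl p_pr p_odd q_prim) !fD.
  by rewrite /pact actD opprD addrACA.
- rewrite /beta !(mulAC p_pr p_odd q_prim (polyA p q 'X)) (mulA_scalel p_pr p_odd q_prim) !fZ.
  by rewrite actD act_opp; congr (_ - _); rewrite /pact actAC.
exists n => t tn; rewrite /beta (fn t) // /pact act0 subr0; apply: fn.
exact: mulA_inAm tn.
Qed.

Lemma UM_alpha (x : M) : is_discrete act -> in_UM act (alpha x).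
Proof.
move=> dis; split=> [s t|c t|]; last exact: dis.
  by rewrite /alpha; case: act_mod.
by rewrite /alpha -(mulA_constl p_pr p_odd q_prim) act_mul.
Qed.

Lemma beta_alpha (x : M) : beta (alpha x) = fun=> 0.
Proof.
apply: functional_extensionality => t.
by rewrite /beta /alpha /pact act_mul subrr.
Qed.

(** If [beta f] vanishes, f commutes with Psi, so induction on P gives f(P(Psi)) = P(Psi) f(1); the
    case of the Phi_k suffices. *)
Lemma ker_beta (f : A p -> M) : is_discrete act -> in_UM act f ->
  beta f = (fun=> 0) -> f = alpha (f (oneA p)).
Proof.
move=> dis fU bf.
have fX t : f (mulA q (polyA p q 'X) t) = pact 'X (f t).
  by apply/eqP; rewrite -subr_eq0; apply/eqP; exact: (congr1 (fun g => g t) bf).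
have XZ : 'X \is a Zpoly := polyOverX _.
have fP P : P \is a Zpoly -> f (polyA p q P) = pact P (f (oneA p)).
  elim/poly_ind: P => [|P c IH] PZ; first by rewrite UM_poly0 // pact0.
  have [{}PZ cZ] := polyOverMXaddC PZ.
  have cP : c%:P \is a Zpoly by rewrite polyOverC.
  rewrite UM_polyD // ?rpredM // pactD // ?rpredM //; congr (_ + _).
    by rewrite mulrC (polyAM p_pr p_odd q_prim) // fX IH // pact_mul.
  by rewrite -[c%:P]mulr1 mul_polyC UM_polyZ ?rpred1 // polyA1 -mul_polyC mulr1.
apply: UM_ext => // [|k]; first exact: UM_alpha.
by rewrite fP // (ThetaZ p_pr p_odd q_prim).
Qed.

Lemma beta_actU (a : A p) (f : A p -> M) : beta (actU q a f) = actU q a (beta f).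
Proof.
apply: functional_extensionality => t.
by rewrite /beta /actU (mulAA p_pr p_odd q_prim).
Qed.

Lemma beta_add (f g : A p -> M) :
  beta (fun t => f t + g t) = (fun t => beta f t + beta g t).
Proof.
by apply: functional_extensionality => t; rewrite /beta /pact actD opprD addrACA.
Qed.

End OperationModule.

(** * The map gamma *)

Section Residue.
Variables (p : nat) (q : int).
Hypotheses (p_pr : prime p) (p_odd : odd p) (q_prim : primitive_mod_p2 p q).
Variables (M : zmodType) (actM : A p -> M -> M).
Hypotheses (M_mod : is_Amod q actM) (M_dis : is_discrete actM).
Variables (N : zmodType) (actN : A p -> N -> N) (iota : M -> N).
Hypothesis N_tensor : is_tensorQ q actM actN iota.

Local Notation Zpoly := (polyOver (pint p)).
Local Notation pactM := (pact q actM).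
Local Notation pactN := (pact q actN).
Local Notation Phi n := (polyA p q (Theta q n)).

Let N_mod : is_Amod q actN. Proof. by case: N_tensor => -[]. Qed.

Let iotaD x y : iota (x + y) = iota x + iota y.
Proof. by case: N_tensor => -[]. Qed.

Let iota0 : iota 0 = 0.
Proof. by apply: (@addrI _ (iota 0)); rewrite -iotaD !addr0. Qed.

Let iotaMn x n : iota (x *+ n) = iota x *+ n.
Proof. by elim: n => [|n IH]; rewrite ?mulr0n ?iota0 // !mulrS iotaD IH. Qed.

Let iota_act a x : iota (actM a x) = actN a (iota x).
Proof. by case: N_tensor => -[]. Qed.

Let iota_pact P x : iota (pactM P x) = pactN P (iota x).
Proof. exact: iota_act. Qed.

Let ThetaZ n : Theta q n \is a Zpoly := ThetaZ p_pr p_odd q_prim n.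
Let ThetadZ n : (Theta q n)^`() \is a Zpoly := polyOver_deriv (ThetaZ n).
Let XqZ n : 'X - (qi q n)%:P \is a Zpoly := XsubqiZ p_pr p_odd q_prim n.

Let N_mulrp_pow_inj k (y : N) : y *+ p ^ k = 0 -> y = 0.
Proof.
case: N_tensor => _ [_ pinj _ _].
by elim: k => [|k IH]; rewrite ?mulr1n // expnSr mulrnA => /pinj.
Qed.

(** The prime-to-p part of [d] is a unit of Z_(p), and the p-part is injective on M tensor Q.
    Division by [d] uses the same factorisation. *)
Let N_mulrn_inj d (y : N) : (0 < d)%N -> y *+ d = 0 -> y = 0.
Proof.
move=> d0; have [m pm ->] := pfactor_coprime p_pr d0.
rewrite mulrnA => /N_mulrp_pow_inj; apply: (mulrn_coprime_inj p_pr p_odd q_prim N_mod).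
by rewrite coprime_sym.
Qed.

Let N_div d (y : N) : (0 < d)%N -> exists z, z *+ d = y.
Proof.
move=> d0; have [m pm ->] := pfactor_coprime p_pr d0.
have [z <-] : exists z, z *+ p ^ logn p d = y.
  case: N_tensor => _ [pdiv _ _ _].
  elim: (logn p d) => [|k [z <-]]; first by exists y.
  by have [w <-] := pdiv z; exists w; rewrite expnS mulrnA.
have [|w <-] := mulrn_coprime_div p_pr p_odd q_prim N_mod z (d := m).
  by rewrite coprime_sym.
by exists w; rewrite mulrnA.
Qed.

(** Discreteness passes from M to M tensor Q: a multiple p^k y comes from M, and p^k is
    injective. *)
Let N_killed (y : N) : exists n, killed_from actN n y.
Proof.
case: N_tensor => _ [_ _ /(_ y)[k [x yx]] _].
have [n nx] := M_dis x; exists n => a an; apply: (@N_mulrp_pow_inj k).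
by rewrite -(actMn N_mod) yx -iota_act nx.
Qed.

(* s_n(g): formally the divided difference (Theta_n(Y) - Theta_n(X)) / (Y - X),
   with Y acting through the argument of g and X on M. *)
Fixpoint ddiff (g : A p -> M) (n : nat) : M :=
  if n is n'.+1 then pactM ('X - (qi q n'.+1)%:P) (ddiff g n') + g (Phi n') else 0.

(** The graph of gamma. *)
Definition is_residue (g : A p -> M) (y : N) : Prop :=
  exists n0, forall n, (n0 <= n)%N -> pactN (Theta q n)^`() y = iota (ddiff g n).

Lemma ddiff_add (f g : A p -> M) (n : nat) :
  ddiff (fun t => f t + g t) n = ddiff f n + ddiff g n.
Proof.
elim: n => [|n IH] /=; first by rewrite addr0.
by rewrite IH (pactDr M_mod) addrACA.
Qed.

Lemma ddiff_pact (P : {poly rat}) (f : A p -> M) (n : nat) :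
  ddiff (fun t => pactM P (f t)) n = pactM P (ddiff f n).
Proof.
elim: n => [|n IH] /=; first by rewrite (pactr0 M_mod).
by rewrite IH (pactDr M_mod) (pactAC p_pr p_odd q_prim M_mod).
Qed.

Lemma beta_Phi (f : A p -> M) (n : nat) : in_UM actM f ->
  beta q actM f (Phi n) = f (Phi n.+1) - pactM ('X - (qi q n.+1)%:P) (f (Phi n)).
Proof.
move=> fU.
have XT : mulA q (polyA p q 'X) (Phi n) = polyA p q (Theta q n.+1 + qi q n.+1 *: Theta q n).
  rewrite -(polyAM p_pr p_odd q_prim) ?polyOverX //; congr polyA.
  by rewrite ThetaS -mul_polyC; ring.
have qZ : pint p (qi q n.+1) := pint_qi p_pr p_odd q_prim n.+1.
have qTZ : qi q n.+1 *: Theta q n \is a Zpoly.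
  by rewrite -mul_polyC rpredM // polyOverC.
have XE x : pactM 'X x = pactM ('X - (qi q n.+1)%:P) x + pactM (qi q n.+1)%:P x.
  by rewrite -(pactD p_pr p_odd q_prim M_mod) ?subrK // polyOverC.
rewrite /beta XT (UM_polyD p_pr p_odd q_prim fU) //.
rewrite (UM_polyZ p_pr p_odd q_prim fU) // XE.
by rewrite opprD addrACA subrr addr0.
Qed.

(** Both sides satisfy the recursion of s_n with initial value 0. For large n both right-hand terms
    vanish, so gamma kills im beta. *)
Lemma ddiff_beta (f : A p -> M) (n : nat) : in_UM actM f ->
  ddiff (beta q actM f) n = f (Phi n) - pactM (Theta q n) (f (Phi 0)).
Proof.
move=> fU; elim: n => [|n IH] /=.
  by rewrite Theta0 (pact1 p_pr p_odd q_prim M_mod) subrr.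
rewrite (beta_Phi _ fU) IH ThetaS.
rewrite [_ * ('X - _)]mulrC (pact_mul p_pr p_odd q_prim M_mod) // (pactBr M_mod).
 by rewrite [LHS]addrC addrA subrK.
Qed.

Lemma residue_beta (f : A p -> M) : in_UM actM f -> is_residue (beta q actM f) 0.
Proof.
move=> fU; have [m fm] := UM_Theta_eventually0 p_pr p_odd q_prim fU.
have [n fn] := M_dis (f (Phi 0)).
exists (maxn m n) => k; rewrite geq_max => /andP[mk nk].
rewrite ddiff_beta // fm // -[Theta q k]mulr1 (pact_killed p_pr p_odd q_prim (n := k)).
  by rewrite subrr iota0 (pactr0 N_mod).
exact: killed_from_leq nk fn.
Qed.

(** A single index suffices: in Theta_(n+1)' = Theta_n + (X - q_(n+1)) Theta_n' the first term kills
    [y], and past [m] the recursion for s_n is homogeneous. *)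
Lemma residue_from (g : A p -> M) (y : N) (m : nat) :
  (forall k, (m <= k)%N -> g (Phi k) = 0) -> pactN (Theta q m) y = 0 ->
  pactN (Theta q m)^`() y = iota (ddiff g m) -> is_residue g y.
Proof.
move=> gm my ym; exists m => n /subnK<-; move: (n - m)%N => {}n.
suff [] : pactN (Theta q (n + m)) y = 0 /\
    pactN (Theta q (n + m))^`() y = iota (ddiff g (n + m)) by [].
elim: n => [//|n [IH1 IH2]]; rewrite addSn /= gm ?leq_addl // addr0 ThetaS; split.
  by rewrite mulrC (pact_mul p_pr p_odd q_prim N_mod) // IH1 (pactr0 N_mod).
rewrite derivM derivXsubC mulr1 (pactD p_pr p_odd q_prim N_mod) ?rpredM //.
by rewrite IH1 addr0 mulrC (pact_mul p_pr p_odd q_prim N_mod) // IH2 iota_pact.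
Qed.

(** For large k, y - z is killed by both Theta_k and its derivative, hence by the Bezout
    constant. *)
Lemma residue_unique (g : A p -> M) (y z : N) :
  is_residue g y -> is_residue g z -> y = z.
Proof.
move=> [m gy] [n gz]; have [r yzr] := N_killed (y - z).
pose k := maxn r (maxn m n).
have [d [U [V [d0 UZ VZ E]]]] := Theta_bezout p_pr p_odd q_prim k.
apply/eqP; rewrite -subr_eq0; apply/eqP/(N_mulrn_inj d0).
rewrite -(pact_nat p_pr p_odd q_prim N_mod) -E.
rewrite (pactD p_pr p_odd q_prim N_mod) ?rpredM // !(pact_mul p_pr p_odd q_prim N_mod) //.
rewrite (pactBr N_mod (Theta q k)^`()) gy ?gz ?leq_max ?leqnn ?orbT // subrr.
rewrite -[Theta q k]mulr1 (pact_killed p_pr p_odd q_prim (n := k)); first by rewrite !(pactr0 N_mod) addr0.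
exact: killed_from_leq (leq_maxl _ _) yzr.
Qed.

Lemma ddiff_tail (g : A p -> M) (m n : nat) :
  (forall k, (m <= k)%N -> g (Phi k) = 0) -> (m <= n)%N ->
  ddiff g n = pactM (\prod_(m <= i < n) ('X - (qi q i.+1)%:P)) (ddiff g m).
Proof.
move=> gm /subnK<-; elim: (n - m)%N => {n} [|n IH].
  by rewrite add0n big_geq // (pact1 p_pr p_odd q_prim M_mod).
rewrite addSn /= gm ?leq_addl // addr0 IH big_nat_recr ?leq_addl //= mulrC.
rewrite (pact_mul p_pr p_odd q_prim M_mod) //.
exact: (prod_XsubqiZ p_pr p_odd q_prim).
Qed.

Lemma residue_exists (g : A p -> M) : in_UM actM g -> exists y, is_residue g y.
Proof.
move=> gU; have [m gm] := UM_Theta_eventually0 p_pr p_odd q_prim gU.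
have [r rP] := M_dis (ddiff g m); pose n := maxn m r.
have sn : killed_from actM n (ddiff g n).
  rewrite (ddiff_tail gm) ?leq_maxl //; apply: (killed_from_act p_pr p_odd q_prim M_mod).
  exact: killed_from_leq (leq_maxr _ _) rP.
have [d [U [V [d0 UZ VZ E]]]] := Theta_bezout p_pr p_odd q_prim n.
(* With U Theta_n' + V Theta_n = d and Theta_n(Psi) s_n = 0, the solution is y = U(Psi) s_n / d. *)
have [y yE] := N_div (iota (pactM U (ddiff g n))) d0.
have sn0 : pactM (Theta q n) (ddiff g n) = 0.
  by rewrite -[Theta q n]mulr1 (pact_killed p_pr p_odd q_prim).
exists y; apply: (residue_from (m := n)) => [k nk||].
- by apply: gm; exact: leq_trans (leq_maxl _ _) nk.
- apply: (N_mulrn_inj d0); rewrite -(pactMn N_mod) yE -iota_pact.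
  by rewrite (pactAC p_pr p_odd q_prim M_mod) sn0 (pactr0 M_mod) iota0.
apply/eqP; rewrite -subr_eq0; apply/eqP/(N_mulrn_inj d0).
rewrite mulrnBl -(pactMn N_mod) yE -iota_pact -iotaMn.
rewrite -(pact_nat p_pr p_odd q_prim M_mod) -E mulrC.
rewrite (pactD p_pr p_odd q_prim M_mod) ?rpredM // !(pact_mul p_pr p_odd q_prim M_mod) //.
by rewrite sn0 (pactr0 M_mod) addr0 subrr.
Qed.

(** * Additivity and A-linearity of gamma *)

Lemma residue_add (f g : A p -> M) (y z : N) :
  is_residue f y -> is_residue g z -> is_residue (fun t => f t + g t) (y + z).
Proof.
move=> [m fy] [n gz]; exists (maxn m n) => k; rewrite geq_max => /andP[mk nk].
by rewrite (pactDr N_mod) fy // gz // ddiff_add iotaD.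
Qed.

Lemma residue_pact (P : {poly rat}) (g : A p -> M) (y : N) :
  is_residue g y -> is_residue (fun t => pactM P (g t)) (pactN P y).
Proof.
move=> [n gy]; exists n => k nk.
by rewrite (pactAC p_pr p_odd q_prim N_mod) gy // ddiff_pact iota_pact.
Qed.

(** The action of Psi on UM differs from applying Psi to the values by [beta], whose residue is
    0. *)
Lemma residue_polyX (g : A p -> M) (y : N) : in_UM actM g ->
  is_residue g y -> is_residue (actU q (polyA p q 'X) g) (pactN 'X y).
Proof.
move=> gU gy; rewrite -[pactN _ _]add0r.
have -> : actU q (polyA p q 'X) g = (fun t => beta q actM g t + pactM 'X (g t)).
  by apply: functional_extensionality => t; rewrite /beta subrK /actU (mulAC p_pr p_odd q_prim).
exact: residue_add (residue_beta gU) (residue_pact 'X gy).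
Qed.

Lemma residue_poly (P : {poly rat}) (g : A p -> M) (y : N) : in_UM actM g ->
  P \is a Zpoly -> is_residue g y -> is_residue (actU q (polyA p q P) g) (pactN P y).
Proof.
move=> gU; elim/poly_ind: P => [|P c IH] PZ gy.
  (* Both sides are zero; the right-hand form lets [residue_pact] apply. *)
  have -> : actU q (polyA p q 0) g = (fun t => pactM 0 (g t)).
    apply: functional_extensionality => t; rewrite (pact0 p_pr p_odd q_prim M_mod).
    case: gU => _ _ [n]; apply; apply: mulA_inAm => //.
    by rewrite -[0](mulr0 (Theta q n)); exact: (polyA_Theta_inAm p_pr p_odd q_prim).
  exact: residue_pact.
have [{}PZ cZ] := polyOverMXaddC PZ.
have cP : c%:P \is a Zpoly by rewrite polyOverC.
have {IH} gP := residue_polyX (UM_actU p_pr p_odd q_prim (polyA p q P) gU) (IH PZ gy).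
rewrite (pactD p_pr p_odd q_prim N_mod) ?rpredM ?polyOverX // [P * 'X]mulrC.
rewrite (pact_mul p_pr p_odd q_prim N_mod) ?polyOverX //.
have -> : actU q (polyA p q ('X * P + c%:P)) g =
    (fun t => actU q (polyA p q 'X) (actU q (polyA p q P) g) t + pactM c%:P (g t)).
  apply: functional_extensionality => t; case: gU => gD gZ _.
  rewrite /actU (polyAD p_pr p_odd q_prim) ?rpredM ?polyOverX //.
  rewrite (polyAM p_pr p_odd q_prim) ?polyOverX //.
  rewrite (mulAC p_pr p_odd q_prim t) (mulADl p_pr p_odd q_prim) gD.
  rewrite (mulAC p_pr p_odd q_prim _ t) (mulAA p_pr p_odd q_prim); congr (_ + _).
  rewrite (polyAC p_pr p_odd q_prim) // (mulA_constl p_pr p_odd q_prim) gZ.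
  by rewrite (act_const p_pr p_odd q_prim) toZpK.
exact: residue_add gP (residue_pact c%:P gy).
Qed.

(** Some A_n annihilates both [y] and [g], so only a polynomial truncation of [a] matters on either
    side. *)
Lemma residue_actU (a : A p) (g : A p -> M) (y : N) : in_UM actM g ->
  is_residue g y -> is_residue (actU q a g) (actN a y).
Proof.
move=> gU gy; have [m my] := N_killed y; have [_ _ [n gn]] := gU.
have mn_y := killed_from_leq (leq_maxl m n) my.
rewrite (act_truncA p_pr p_odd q_prim N_mod a mn_y).
have -> : actU q a g = actU q (polyA p q (truncA q a (maxn m n))) g.
  apply: functional_extensionality => t; rewrite /actU.
  have [u un {1}->] := truncA_tail p_pr p_odd q_prim a (maxn m n).
  rewrite (mulAC p_pr p_odd q_prim) (mulADl p_pr p_odd q_prim).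
  rewrite !(mulAC p_pr p_odd q_prim _ t); case: gU => -> _ _.
  rewrite [X in _ + X]gn ?addr0 //; apply: mulA_inAm => // i ni.
  by apply: un; rewrite leq_max ni orbT.
apply: residue_poly => //; exact: (truncAZ p_pr p_odd q_prim).
Qed.

Lemma residue0_beta (g : A p -> M) : in_UM actM g -> is_residue g 0 ->
  exists2 f, in_UM actM f & g = beta q actM f.
Proof.
move=> gU [m g0]; have [n gn] := UM_Theta_eventually0 p_pr p_odd q_prim gU.
pose r := maxn m n.
have [k rk] : exists k, ddiff g r *+ p ^ k = 0.
  case: N_tensor => _ [_ _ _ ker]; apply/ker.
  by rewrite -g0 ?leq_maxl // (pactr0 N_mod).
have [j rj] := M_dis (ddiff g r).
(* Both Theta_j(Psi) and p^k kill s_r(g), so the later factors up to [s] do too. *)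
have [s rs [V [Z [VZ ZZ E]]]] := prod_Xsubqi_mod p_pr p_odd q_prim r j k.
have gr i : (r <= i)%N -> g (Phi i) = 0.
  by move=> ri; apply: gn; exact: leq_trans (leq_maxr _ _) ri.
have s0 : ddiff g s = 0.
  rewrite (ddiff_tail gr rs) E (pactD p_pr p_odd q_prim M_mod) ?rpredM //; last first.
    by rewrite -mul_polyC rpredM // polyOverC; exact: pint_nat.
  rewrite (pact_killed p_pr p_odd q_prim) // add0r -mul_polyC mulrC (pact_mul p_pr p_odd q_prim M_mod) //.
    by rewrite (pact_nat p_pr p_odd q_prim M_mod) rk (pactr0 M_mod).
  by rewrite polyOverC; exact: pint_nat.
have ev0 i : (s <= i)%N -> ddiff g i = 0.
  move=> si; rewrite (ddiff_tail (m := s)) // ?s0 ?(pactr0 M_mod) // => l sl.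
  by apply: gr; exact: leq_trans sl.
(* The sequence s_n(g) now has finite support, hence defines the preimage f with f_n = s_n(g). *)
have [f fU fE] := UM_of_seq p_pr p_odd q_prim M_mod ev0.
exists f => //; apply: (UM_ext p_pr p_odd q_prim gU (UM_beta p_pr p_odd q_prim M_mod fU)) => i.
by rewrite (beta_Phi _ fU) !fE /= [X in X - _]addrC addrK.
Qed.

Lemma residue_onto (y : N) : exists2 g, in_UM actM g & is_residue g y.
Proof.
case: N_tensor => _ [_ _ /(_ y)[k [x yx]] _].
(* Passing to n + 1 makes the end of the product below a successor s + 1, leaving index [s] for the
   support of [g]. *)
have [n ny] := N_killed y; have {}ny := killed_from_leq (leqnSn n) ny.
have [[//|s] ns [V [Z [VZ ZZ E]]]] := prod_Xsubqi_mod p_pr p_odd q_prim n.+1 n.+1 k.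
set W := \prod_(_ <= i < _) _ in E.
have WZ : W \is a Zpoly := prod_XsubqiZ p_pr p_odd q_prim _ _.
have W'Z : W^`() \is a Zpoly := polyOver_deriv WZ.
(* Since Theta_(n+1) and p^k y - x vanish on passing to [y] and M tensor Q, the product rule for
   Theta_(s+1) = Theta_(n+1) W turns Theta_(s+1)'(Psi) y into the image of this element, which is
   s_(s+1)(g). *)
pose x' := pactM ((Theta q n.+1)^`() * Z) x.
have u0 i : (s < i)%N -> (if i == s then x' else 0) = 0 by case: ltngtP.
have [g gU gE] := UM_of_seq p_pr p_odd q_prim M_mod u0.
exists g => //; apply: (residue_from (m := s.+1)) => [i|| /=]; first by rewrite gE; exact: u0.
  rewrite -[Theta q s.+1]mulr1 (pact_killed p_pr p_odd q_prim) //.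
  exact: killed_from_leq ny.
have s0 i : (i <= s)%N -> ddiff g i = 0.
  elim: i => [//|i IH] lis /=; rewrite IH 1?ltnW // (pactr0 M_mod) add0r gE.
  by rewrite ltn_eqF.
rewrite s0 // (pactr0 M_mod) add0r gE eqxx iota_pact -yx.
rewrite (Theta_cat q ns) -/W derivM (pactD p_pr p_odd q_prim N_mod) ?rpredM //.
rewrite (pact_killed p_pr p_odd q_prim) // addr0 !(pact_mul p_pr p_odd q_prim N_mod) //.
congr pactN; rewrite E (pactD p_pr p_odd q_prim N_mod) ?rpredM //; last first.
  by rewrite -mul_polyC rpredM // polyOverC; exact: pint_nat.
rewrite (pact_killed p_pr p_odd q_prim) // add0r -mul_polyC.
rewrite mulrC (pact_mul p_pr p_odd q_prim N_mod) //.
  by rewrite (pact_nat p_pr p_odd q_prim N_mod).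
by rewrite polyOverC; exact: pint_nat.
Qed.

(** On UM a residue exists and is unique, so the choice is forced; other values are irrelevant. *)
Definition residue (g : A p -> M) : N := epsilon (inhabits 0) (is_residue g).

Lemma residueP (g : A p -> M) : in_UM actM g -> is_residue g (residue g).
Proof. by move=> gU; apply: epsilon_spec; exact: residue_exists. Qed.

Lemma residueE (g : A p -> M) (y : N) : is_residue g y -> residue g = y.
Proof.
by move=> gy; apply: (residue_unique (g := g)) => //; apply: epsilon_spec; exists y.
Qed.

End Residue.

Theorem theorem5p7 (p : nat) (q : int) :
  prime p -> odd p -> primitive_mod_p2 p q ->
  forall (M : zmodType) (actM : A p -> M -> M),
  is_Amod q actM -> is_discrete actM ->
  forall (N : zmodType) (actN : A p -> N -> N) (iota : M -> N),
  is_tensorQ q actM actN iota ->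
  exists (alpha : M -> (A p -> M)) (beta : (A p -> M) -> (A p -> M))
         (gamma : (A p -> M) -> N),
  [/\ (* the maps are well defined on UM *)
      (forall x, in_UM actM (alpha x)),
      (forall f, in_UM actM f -> in_UM actM (beta f)),
      (* and are homomorphisms of A-modules *)
      ((forall x y, alpha (x + y) = (fun t => alpha x t + alpha y t)) /\
       (forall a x, alpha (actM a x) = actU q a (alpha x))),
      ((forall f g, in_UM actM f -> in_UM actM g -> beta (fun t => f t + g t) = (fun t => beta f t + beta g t)) /\
       (forall a f, in_UM actM f -> beta (actU q a f) = actU q a (beta f))) &
      ((forall f g, in_UM actM f -> in_UM actM g -> gamma (fun t => f t + g t) = gamma f + gamma g) /\
       (forall a f, in_UM actM f -> gamma (actU q a f) = actN a (gamma f)))] /\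
  [/\ (* exactness at M, UM, UM, M (x) Q *)
      (forall x, alpha x = (fun _ => 0) -> x = 0),
      (forall f, in_UM actM f -> (beta f = (fun _ => 0) <-> exists x, f = alpha x)),
      (forall g, in_UM actM g ->
          (gamma g = 0 <-> exists f, in_UM actM f /\ g = beta f)) &
      (forall y : N, exists g, in_UM actM g /\ gamma g = y)].

Proof.
move=> p_pr p_odd q_prim M actM M_mod M_dis N actN iota N_tensor.
exists (alpha actM), (beta q actM), (residue q actM actN iota).
have gP := residueP p_pr p_odd q_prim M_mod M_dis N_tensor.
have gE := residueE p_pr p_odd q_prim M_dis N_tensor.
split; split.
- by move=> x; apply: (UM_alpha p_pr p_odd q_prim M_mod).
- exact: (UM_beta p_pr p_odd q_prim M_mod).
- split=> [x y|a x]; apply: functional_extensionality => t.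
    by case: M_mod => [actD _ _ _]; exact: actD.
  by rewrite /actU /alpha (act_mul M_mod).
- split=> [f g _ _|a f _]; first exact: (beta_add M_mod).
  exact: (beta_actU p_pr p_odd q_prim).
- split=> [f g fU gU|a f fU]; apply: gE.
    by apply: (residue_add M_mod N_tensor); exact: gP.
  by apply: (residue_actU p_pr p_odd q_prim M_mod M_dis N_tensor) => //; exact: gP.
- move=> x /(congr1 (fun f => f (oneA p))); rewrite /alpha.
  by case: M_mod => [_ _ _ ->].
- move=> f fU; split=> [bf|[x ->]]; last exact: (beta_alpha M_mod).
  by exists (f (oneA p)); apply: (ker_beta p_pr p_odd q_prim M_mod).
- move=> g gU; split=> [g0|[f [fU ->]]].
    have := gP g gU; rewrite g0.
    by case/(residue0_beta p_pr p_odd q_prim M_mod M_dis N_tensor gU) => f fU ->; exists f.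
  exact/gE/(residue_beta p_pr p_odd q_prim M_mod M_dis N_tensor).
- move=> y.
  have [g gU gy] := residue_onto p_pr p_odd q_prim M_mod M_dis N_tensor y.
  by exists g; split=> //; exact: gE.
Qed.
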